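(* Let $(\mathbf r,\mathbf h)$ be a pattern, with $\mathbf r=(r_1,\dots,r_t)$ and $\mathbf h=(h_1,\dots,h_t)$, and let $H=\sum_{j=1}^t h_j$ and $B=\sum_{j=1}^t h_j|r_j|$. Let $N\ge 1$ be an integer, and assume that $p$ is a prime such that $p>B$ and $p\nmid r_1\cdots r_t$. Then $$T^{(p^N;p^{N-1})}_{\mathbf r,\mathbf h}(\alpha_{1,p^N},\dots,\alpha_{p^N-1,p^N})=p\,\mathsf S_0(\mathbf r,\mathbf h)-2^H,$$ $$T^{(p^N;p^{s})}_{\mathbf r,\mathbf h}(\alpha_{1,p^N},\dots,\alpha_{p^N-1,p^N})=\varphi(p^{N-s})\,\mathsf S_0(\mathbf r,\mathbf h)\qquad(0\le s\le N-2).$$ Consequently, $$T^{(p^N)}_{\mathbf r,\mathbf h}(\alpha_{1,p^N},\dots,\alpha_{p^N-1,p^N})=p^N\,\mathsf S_0(\mathbf r,\mathbf h)-2^H.$$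
   Context: A pattern $(\mathbf r,\mathbf h)$ consists of an integer $t\ge 1$, a tuple $\mathbf r=(r_1,\dots,r_t)$ of nonzero integers with $r_1=1$, and a tuple $\mathbf h=(h_1,\dots,h_t)$ of nonnegative integers. For $n\ge 2$ put $\Omega_n=\{1,\dots,n-1\}$ and $\alpha_{k,n}=\cos(2\pi k/n)$ for $k\in\Omega_n$. For an integer $r$ with $\gcd(r,n)=1$, let $\sigma_r:\Omega_n\to\Omega_n$ be the permutation determined by $\sigma_r(k)\equiv rk\pmod n$. For $d\mid n$, $d<n$, put $\mathcal O_d(n)=\{k\in\Omega_n:\gcd(k,n)=d\}$. When $\gcd(n,r_1\cdots r_t)=1$, define $$T^{(n)}_{\mathbf r,\mathbf h}(x_1,\dots,x_{n-1})=\sum_{k\in\Omega_n}\prod_{j=1}^t\bigl(2x_{\sigma_{r_j}(k)}\bigr)^{h_j},\qquad T^{(n;d)}_{\mathbf r,\mathbf h}(x_1,\dots,x_{n-1})=\sum_{k\in\mathcal O_d(n)}\prod_{j=1}^t\bigl(2x_{\sigma_{r_j}(k)}\bigr)^{h_j}.$$ $\mathsf S_0(\mathbf r,\mathbf h)$ denotes the constant coefficient (coefficient of $u^0$) of the Laurent polynomial $\prod_{j=1}^t(u^{r_j}+u^{-r_j})^{h_j}$, and $\varphi$ is Euler's totient function. *)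

(* Defs.v *)
From HB Require Import structures.
From mathcomp Require Import all_boot all_order all_algebra.
From mathcomp Require Import finmap.
From mathcomp Require Import reals trigo.

Set Implicit Arguments.
Unset Strict Implicit.
Unset Printing Implicit Defensive.

Import Order.TTheory GRing.Theory Num.Theory.

Local Open Scope fset_scope.
Local Open Scope ring_scope.

(* Integer Laurent polynomials in one variable u: the finitely supported
   families of coefficients, f i being the coefficient of u^i, with pointwise
   addition and the Cauchy product. *)
Definition laurent : Type := {fsfun int -> int with 0}.

HB.instance Definition _ := Choice.on laurent.

Section LaurentRing.

Implicit Types f g h : laurent.

Definition lau0 : laurent := [fsfun with 0].

Definition lau_opp f : laurent := [fsfun k in finsupp f => - f k | 0].

Definition lau_add f g : laurent :=
  [fsfun k in finsupp f `|` finsupp g => f k + g k | 0].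

(* u^r *)
Definition lau_monom (r : int) : laurent := [fsfun k in [fset r] => 1 | 0].

Definition lau_mul f g : laurent :=
  [fsfun k in [fset i + j | i in finsupp f, j in finsupp g] =>
     \sum_(i <- finsupp f) f i * g (k - i) | 0].

Lemma lau0E k : lau0 k = 0.
Proof. by rewrite fsfunE. Qed.

Lemma lau_oppE f k : lau_opp f k = - f k.
Proof. by rewrite fsfunE; case: finsuppP => //= _; rewrite oppr0. Qed.

Lemma lau_addE f g k : lau_add f g k = f k + g k.
Proof.
by rewrite fsfunE inE; case: finsuppP => //= _; case: finsuppP => //= _; rewrite addr0.
Qed.

Lemma lau_monomE r k : lau_monom r k = (k == r)%:R.
Proof. by rewrite fsfunE inE; case: eqP. Qed.

Lemma lau_mulE f g k : lau_mul f g k = \sum_(i <- finsupp f) f i * g (k - i).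
Proof.
rewrite fsfunE; case: ifPn => // nk.
rewrite big_seq big1 // => i fi.
case: (finsuppP g (k - i)) => [|gki]; first by rewrite mulr0.
by case/negP: nk; apply/imfset2P; exists i => //; exists (k - i); rewrite ?subrKC.
Qed.

Lemma lau_sumE f (A : {fset int}) (phi : int -> int) : finsupp f `<=` A ->
  \sum_(i <- finsupp f) f i * phi i = \sum_(i <- A) f i * phi i.
Proof.
move=> sfA; apply: big_fset_incl => // i _ nfi.
by rewrite fsfun_dflt ?mul0r.
Qed.

Lemma lau_mul_sumE f g (phi : int -> int) :
  \sum_(m <- finsupp (lau_mul f g)) lau_mul f g m * phi m =
  \sum_(i <- finsupp f) \sum_(j <- finsupp g) f i * g j * phi (i + j).
Proof.
pose A := [fset i + j | i in finsupp f, j in finsupp g].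
rewrite (@lau_sumE _ A); last exact: finsupp_sub.
under eq_bigr do rewrite lau_mulE mulr_suml.
rewrite exchange_big /= big_seq [RHS]big_seq; apply: eq_bigr => i fi.
have shI : injective (fun j : int => i + j) by exact: addrI.
rewrite -(@big_fset_incl _ _ _ _ [fset i + j | j in finsupp g]).
- rewrite big_imfset /=; last by move=> ? ? _ _ /shI.
  by apply: eq_bigr => j _; rewrite addrAC subrr add0r.
- by apply/fsubsetP => _ /imfsetP[j gj ->]; apply/imfset2P; exists i => //; exists j.
- move=> k _ /negP nk; case: (finsuppP g (k - i)) => [|gki].
    by rewrite mulr0 mul0r.
  by case: nk; apply/imfsetP; exists (k - i); rewrite ?subrKC.
Qed.

Lemma lau_addA : associative lau_add.
Proof. by move=> f g h; apply/fsfunP => k; rewrite !lau_addE addrA. Qed.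

Lemma lau_addC : commutative lau_add.
Proof. by move=> f g; apply/fsfunP => k; rewrite !lau_addE addrC. Qed.

Lemma lau_add0 : left_id lau0 lau_add.
Proof. by move=> f; apply/fsfunP => k; rewrite lau_addE lau0E add0r. Qed.

Lemma lau_addN : left_inverse lau0 lau_opp lau_add.
Proof. by move=> f; apply/fsfunP => k; rewrite lau_addE lau_oppE lau0E addNr. Qed.

Lemma lau_mulC : commutative lau_mul.
Proof.
have H f g k : lau_mul f g k =
  \sum_(i <- finsupp f) \sum_(j <- finsupp g) f i * g j * (i + j == k)%:R.
  rewrite -(lau_mul_sumE f g (fun m => (m == k)%:R)).
  rewrite (lau_sumE _ (fsubsetU1 k (finsupp (lau_mul f g)))).
  rewrite (big_fsetD1 k) ?inE ?eqxx //= mulr1 big_seq big1 ?addr0 // => i.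
  by rewrite !inE => /andP[/negPf-> _]; rewrite mulr0.
move=> f g; apply/fsfunP => k; rewrite !H exchange_big /=.
apply: eq_bigr => i _; apply: eq_bigr => j _.
by rewrite [g i * f j]mulrC [i + j]addrC.
Qed.

Lemma lau_mulA : associative lau_mul.
Proof.
move=> f g h; apply/fsfunP => k; rewrite !lau_mulE.
rewrite (lau_mul_sumE f g (fun m => h (k - m))).
apply: eq_bigr => i _; rewrite lau_mulE mulr_sumr.
by apply: eq_bigr => j _; rewrite mulrA opprD addrA.
Qed.

Lemma lau_mul1 : left_id (lau_monom 0) lau_mul.
Proof.
move=> f; apply/fsfunP => k; rewrite lau_mulE.
rewrite (@lau_sumE _ [fset 0] (fun i => f (k - i))); last exact: finsupp_sub.
by rewrite big_seq_fset1 lau_monomE eqxx mul1r subr0.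
Qed.

Lemma lau_mulDl : left_distributive lau_mul lau_add.
Proof.
move=> f g h; apply/fsfunP => k; rewrite lau_addE !lau_mulE.
have sub : finsupp (lau_add f g) `<=` finsupp f `|` finsupp g.
  exact: finsupp_sub.
rewrite (lau_sumE (fun i => h (k - i)) sub).
rewrite (lau_sumE (fun i => h (k - i)) (fsubsetUl (finsupp f) (finsupp g))).
rewrite (lau_sumE (fun i => h (k - i)) (fsubsetUr (finsupp f) (finsupp g))).
by rewrite -big_split; apply: eq_bigr => i _; rewrite lau_addE mulrDl.
Qed.

Lemma lau_1neq0 : lau_monom 0 != lau0.
Proof. by apply/eqP => /fsfunP/(_ 0); rewrite lau_monomE lau0E. Qed.

End LaurentRing.

HB.instance Definition _ :=
  GRing.isZmodule.Build laurent lau_addA lau_addC lau_add0 lau_addN.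

HB.instance Definition _ := GRing.Zmodule_isComNzRing.Build laurent
  lau_mulA lau_mulC lau_mul1 lau_mulDl lau_1neq0.

Definition constant_coef (f : laurent) : int := f 0.

Definition is_pattern (t : nat) (r : t.-tuple int) (h : t.-tuple nat) : Prop :=
  [/\ (0 < t)%N, forall j : 'I_t, tnth r j != 0 & r`_0 = 1].

Definition S0 (t : nat) (r : t.-tuple int) (h : t.-tuple nat) : int :=
  constant_coef
    (\prod_(j < t) (lau_monom (tnth r j) + lau_monom (- tnth r j)) ^+ tnth h j).

(* Restricts to a permutation of {1, ..., n - 1} when gcd(r, n) = 1: this is
   sigma_perm. *)
Definition sigma (n : nat) (r : int) (k : nat) : nat :=
  `|((r * k%:Z) %% n%:Z)%Z|%N.

Lemma sigma_congr n r k : (0 < n)%N ->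
  ((sigma n r k)%:Z = r * k%:Z %[mod n%:Z])%Z.
Proof.
move=> n0; rewrite /sigma gez0_abs ?modz_ge0 ?modz_mod //.
by rewrite eqz_nat -lt0n.
Qed.

Lemma sigma_perm n r : (1 < n)%N -> coprimez r n%:Z ->
  perm_eq [seq sigma n r k | k <- index_iota 1 n] (index_iota 1 n).
Proof.
move=> n1 co; have n0 : (0 < n)%N by apply: ltnW.
have nz : n%:Z != 0 by rewrite eqz_nat -lt0n.
have eqm a b : (r * a%:Z = r * b%:Z %[mod n%:Z])%Z ->
    (a < n)%N -> (b < n)%N -> a = b.
  move=> /eqP; rewrite eqz_mod_dvd -mulrBr Gauss_dvdzr 1?coprimez_sym //.
  rewrite -eqz_mod_dvd => /eqP + la lb.
  by rewrite !modz_small ?lez_nat ?ltz_nat //= => -[].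
have inj : {in index_iota 1 n &, injective (sigma n r)}.
  move=> a b; rewrite !mem_index_iota => /andP[_ la] /andP[_ lb] eab.
  by apply: eqm => //; rewrite -!sigma_congr // eab.
have us : uniq [seq sigma n r k | k <- index_iota 1 n].
  by rewrite map_inj_in_uniq ?iota_uniq.
apply: uniq_perm (iota_uniq _ _) _ => //.
apply: (uniq_min_size us _ _).2; last by rewrite size_map.
move=> _ /mapP[k + ->]; rewrite !mem_index_iota => /andP[k0 kn].
apply/andP; split; last first.
  by rewrite -ltz_nat /sigma gez0_abs ?modz_ge0 // ltz_pmod.
rewrite lt0n; apply: contraTN k0 => /eqP s0; rewrite -eqn0Ngt; apply/eqP.
by apply: eqm => //; rewrite -sigma_congr // s0 mulr0.
Qed.

(* The family x_1, ..., x_(n - 1) is encoded as x : nat -> R: when n is coprime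
   to all the tnth r j, the only case in which T_sum and T_orb are meaningful,
   no other value of x is read. *)
Definition T_sum (R : comNzRingType) (n t : nat) (r : t.-tuple int)
    (h : t.-tuple nat) (x : nat -> R) : R :=
  \sum_(1 <= k < n) \prod_(j < t) (2 * x (sigma n (tnth r j) k)) ^+ tnth h j.

Definition T_orb (R : comNzRingType) (n d t : nat) (r : t.-tuple int)
    (h : t.-tuple nat) (x : nat -> R) : R :=
  \sum_(1 <= k < n | gcdn k n == d)
    \prod_(j < t) (2 * x (sigma n (tnth r j) k)) ^+ tnth h j.

Definition alpha (R : realType) (n k : nat) : R := cos (2 * pi * k%:R / n%:R).

(* Main.v *)
(* Let P(m) be the sum over 0 <= k < m of the product of the
   (2 cos(2 pi r_j k / m))^(h_j). The product is an even trigonometric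
   polynomial of degree at most B with constant coefficient S0, and the m-point
   equispaced quadrature is exact in degrees below m, so P(m) = m S0 whenever
   m > B, while P(1) = 2^H. The k with gcd(k, p^N) = p^s are the multiples of
   p^s that are not multiples of p^(s+1), so the orbit sum is
   P(p^(N-s)) - P(p^(N-s-1)), and the full sum is P(p^N) - P(1). *)
Require Import Defs.
From mathcomp Require Import all_boot all_order all_algebra.
From mathcomp Require Import finmap zify ring.
From mathcomp Require Import reals trigo.

Import Order.TTheory GRing.Theory Num.Theory.

Local Open Scope ring_scope.

Section Auxiliary.

Set Implicit Arguments.
Unset Strict Implicit.

Lemma sum_multiples (V : nmodType) (F : nat -> V) (a d : nat) : (0 < d)%N ->
  \sum_(0 <= k < a * d | (d %| k)%N) F k = \sum_(0 <= j < a) F (j * d)%N.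
Proof.
move=> d0; elim: a => [|a IHa]; first by rewrite mul0n !big_geq.
(* In the added block from [a * d] to [a * d + d - 1], only the first index is a multiple of [d]. *)
rewrite big_nat_recr //= -IHa (@big_cat_nat _ _ _ (a * d)) ?leq_mul //=.
congr (_ + _); rewrite big_ltn_cond ?ltn_mul2r ?d0 ?ltnSn // dvdn_mull //.
rewrite big_nat_cond big1 ?addr0 // => k /andP[/andP[lo hi] /dvdnP[q kq]].
move: lo hi; rewrite kq !ltn_mul2r ltnS d0 /= => /leq_trans h/h.
by rewrite ltnn.
Qed.

(** The gcd is some [p ^ m], and [p ^ e] divides [k] iff [e <= m] as long as [e <= N]. Since
    [s < N], this applies to [e = s.+1] too, and both sides say [m = s]. *)
Lemma gcd_pfactor_eq (p N s k : nat) : prime p -> (s < N)%N ->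
  (gcdn k (p ^ N) == p ^ s)%N = (p ^ s %| k)%N && ~~ (p ^ s.+1 %| k)%N.
Proof.
move=> pp sN; have p1 := prime_gt1 pp.
have [m mN gE] := dvdn_pfactor _ N pp (dvdn_gcdr k (p ^ N)).
have dE e : (e <= N)%N -> (p ^ e %| k)%N = (e <= m)%N.
  by move=> eN; rewrite -(dvdn_Pexp2l _ _ p1) -gE dvdn_gcd dvdn_exp2l // andbT.
by rewrite gE !dE ?(ltnW sN) // -leqNgt eqn_exp2l // eqn_leq andbC.
Qed.

(* The term k = 0 may be added freely, since gcd(0, p^N) = p^N is not p^s. *)
Lemma sum_gcd_pfactor (V : zmodType) (F : nat -> V) (p N s : nat) :
    prime p -> (s < N)%N ->
  \sum_(1 <= k < p ^ N | gcdn k (p ^ N) == (p ^ s)%N) F k =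
  \sum_(0 <= j < p ^ (N - s)) F (j * p ^ s)%N -
  \sum_(0 <= j < p ^ (N - s.+1)) F (j * p ^ s.+1)%N.
Proof.
move=> pp sN; have p0 := prime_gt0 pp.
rewrite -!sum_multiples ?expn_gt0 ?p0 // -!expnD !subnK // 1?ltnW //.
have -> : \sum_(1 <= k < p ^ N | gcdn k (p ^ N) == (p ^ s)%N) F k =
          \sum_(0 <= k < p ^ N | gcdn k (p ^ N) == (p ^ s)%N) F k.
  rewrite [RHS]big_ltn_cond ?expn_gt0 ?p0 // gcd0n.
  by rewrite eqn_exp2l ?prime_gt1 // gtn_eqF.
rewrite [X in _ = X - _](bigID (fun k => p ^ s.+1 %| k)%N) /= addrC.
rewrite [X in _ = _ + X - _](eq_bigl (fun k => p ^ s.+1 %| k)%N) => [|k].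
  rewrite addrK; apply: eq_bigl => k; exact: gcd_pfactor_eq.
by apply: andb_idl; apply: dvdn_trans; rewrite dvdn_exp2l.
Qed.

Section Quadrature.

Variable R : realType.
Implicit Types (m n B : nat) (i q : int) (f : laurent) (g : R -> R) (x : R).

Lemma cosD_int2pi x q : cos (x + q%:~R * (pi *+ 2)) = cos x.
Proof.
have cosn n (y : R) : cos (y + n%:R * (pi *+ 2)) = cos y.
  by rewrite mulr_natl; apply: periodicn; exact: cosD2pi.
case: q => n; first exact: cosn.
by rewrite NegzE mulrNz mulNr -[LHS](cosn n.+1) subrK.
Qed.

Definition node m (j : nat) : R := 2 * pi * j%:R / m%:R.

(** Reducing [q * k] modulo [n] shifts the angle by a whole number of turns. *)
Lemma alpha_sigma n q (k : nat) : (0 < n)%N ->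
  alpha R n (sigma n q k) = cos (q%:~R * node n k).
Proof.
move=> n0; have nR : n%:R != 0 :> R by rewrite pnatr_eq0 -lt0n.
have sE : (sigma n q k)%:R = (q * k%:Z)%:~R - ((q * k%:Z) %/ n%:Z)%Z%:~R * n%:R :> R.
  rewrite {1}(divz_eq (q * k%:Z) n%:Z) rmorphD rmorphM /= [X in X - _]addrC addrK.
  by rewrite /sigma -[LHS]pmulrn natr_absz ger0_norm // modz_ge0 // eqz_nat -lt0n.
rewrite /alpha sE -[LHS](cosD_int2pi _ ((q * k%:Z) %/ n%:Z)%Z) rmorphM /=.
by congr cos; rewrite /node -[pi *+ 2]mulr_natl; field.
Qed.

(** Telescoping: [2 sin x cos (2jx) = sin ((2j+1)x) - sin ((2j-1)x)]; the term [sin x] comes from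
    the lower end [j = 0]. *)
Lemma sum_cos_arith n x :
  2 * sin x * \sum_(0 <= j < n) cos (j%:R * (2 * x)) =
  sin ((2 * n%:R - 1) * x) + sin x.
Proof.
elim: n => [|n IHn].
  by rewrite big_geq // mulr0 mulr0 sub0r mulN1r sinN addNr.
rewrite big_nat_recr //= mulrDr IHn.
have -> : (2 * n.+1%:R - 1) * x = n%:R * (2 * x) + x by rewrite -natr1; ring.
have -> : (2 * n%:R - 1) * x = n%:R * (2 * x) - x by ring.
by rewrite sinB sinD; ring.
Qed.

Lemma sum_cos_nodes m i : (`|i| < m)%N ->
  \sum_(0 <= j < m) cos (i%:~R * node m j) = m%:R * (i == 0)%:R.
Proof.
move=> im; have m0 : 0 < m%:R :> R by rewrite ltr0n (leq_ltn_trans _ im).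
have -> : \sum_(0 <= j < m) cos (i%:~R * node m j) =
          \sum_(0 <= j < m) cos (`|i|%N%:R * node m j).
  apply: eq_bigr => j _; case: i {im} => n; first by rewrite pmulrn.
  by rewrite NegzE abszN mulrNz mulNr cosN.
rewrite -absz_eq0; case: `|i|%N im => [_|n nm].
  under eq_bigr do rewrite mul0r cos0.
  by rewrite big_const_nat iter_addr_0 subn0 mulr1.
(* Half the angular step. As [0 < n.+1 < m], it lies strictly between 0 and [pi], so [2 * sin x] can
   be cancelled. *)
pose x : R := n.+1%:R * pi / m%:R.
have x0 : 0 < sin x.
  apply: sin_gt0_pi; rewrite divr_gt0 //= ?mulr_gt0 ?ltr0n ?pi_gt0 //.
  by rewrite ltr_pdivrMr // mulrC ltr_pM2l ?pi_gt0 // ltr_nat.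
have sx0 : 2 * sin x != 0 by rewrite gt_eqF ?mulr_gt0 ?ltr0n.
apply: (mulfI sx0).
rewrite !mulr0.
under eq_bigr => j _.
  have -> : n.+1%:R * node m j = j%:R * (2 * x).
    by rewrite /node /x; field; rewrite gt_eqF.
  over.
rewrite sum_cos_arith.
(* Here [m x] is a multiple of [pi], so the two sines in the closed form cancel. *)
have -> : (2 * m%:R - 1) * x = - x + pi *+ 2 *+ n.+1.
  by rewrite -[_ *+ n.+1]mulr_natr -[pi *+ 2]mulr_natr /x; field; rewrite gt_eqF.
by rewrite (periodicn (@sinD2pi R)) sinN addNr.
Qed.

(* The m equally spaced nodes compute the low-degree Fourier coefficients of g,
   which are those of f. The frequency i, rather than just the constant
   coefficient, makes the property inductive. *)
Definition quadrature m f g B := forall i, (`|i| + B < m)%N ->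
  \sum_(0 <= j < m) cos (i%:~R * node m j) * g (node m j) = m%:R * (f i)%:~R.

Lemma quadrature1 m : quadrature m 1 (fun=> 1) 0.
Proof.
move=> i; rewrite addn0 => im; under eq_bigr do rewrite mulr1.
by rewrite sum_cos_nodes // [(1 : laurent) i]lau_monomE; case: (i == 0).
Qed.

Lemma lau_monom_mulE q f i : (lau_monom q * f) i = f (i - q).
Proof.
rewrite [LHS]lau_mulE (@lau_sumE _ [fset q]%fset (fun k => f (i - k))).
  by rewrite big_seq_fset1 lau_monomE eqxx mul1r.
exact: finsupp_sub.
Qed.

(** Product-to-sum turns the new cosine into the frequencies [i - q] and [i + q], matching the two
    shifts of the coefficients of [f]; both have size at most [|i| + |q|], hence the new bound. *)
Lemma quadratureM m f g B q : quadrature m f g B ->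
  quadrature m ((lau_monom q + lau_monom (- q)) * f)
    (fun x => 2 * cos (q%:~R * x) * g x) (`|q| + B).
Proof.
move=> fg i im; rewrite mulrDl [(_ + _ : laurent) i]lau_addE !lau_monom_mulE opprK.
rewrite rmorphD mulrDr /= -!fg; [|lia|lia].
rewrite -big_split; apply: eq_bigr => j _ /=.
have -> : (i - q)%:~R * node m j = i%:~R * node m j - q%:~R * node m j.
  by rewrite rmorphB mulrBl.
have -> : (i + q)%:~R * node m j = i%:~R * node m j + q%:~R * node m j.
  by rewrite rmorphD mulrDl.
by rewrite cosB cosD; ring.
Qed.

Lemma quadratureX m f g B q n : quadrature m f g B ->
  quadrature m ((lau_monom q + lau_monom (- q)) ^+ n * f)
    (fun x => (2 * cos (q%:~R * x)) ^+ n * g x) (n * `|q| + B).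
Proof.
move=> fg; elim: n => [|n IHn] i im.
  by rewrite expr0 mul1r -fg //; apply: eq_bigr => j _; rewrite expr0 mul1r.
rewrite exprS -mulrA -(quadratureM IHn); last by lia.
by apply: eq_bigr => j _; rewrite exprS -!mulrA.
Qed.

Lemma quadrature_prod m (I : Type) (s : seq I) (r : I -> int) (h : I -> nat) :
  quadrature m (\prod_(j <- s) (lau_monom (r j) + lau_monom (- r j)) ^+ h j)
    (fun x => \prod_(j <- s) (2 * cos ((r j)%:~R * x)) ^+ h j)
    (\sum_(j <- s) h j * `|r j|)%N.
Proof.
elim: s => [|j s IHs] i.
  rewrite !big_nil => im; rewrite -(quadrature1 im).
  by apply: eq_bigr => j _; rewrite big_nil.
rewrite !big_cons => im; rewrite -(quadratureX IHs im).
by apply: eq_bigr => k _; rewrite big_cons.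
Qed.

End Quadrature.

End Auxiliary.

Theorem theorem4p13 (R : realType) (t : nat) (r : t.-tuple int)
    (h : t.-tuple nat) (pat : is_pattern r h) (N p : nat) :
  let H : nat := (\sum_(j < t) tnth h j)%N in
  let B : nat := (\sum_(j < t) tnth h j * `|tnth r j|)%N in
  (1 <= N)%N -> prime p -> (B < p)%N ->
  ~~ (p%:Z %| \prod_(j < t) tnth r j)%Z ->
  [/\ T_orb (p ^ N) (p ^ (N - 1)) r h (alpha R (p ^ N)) =
        p%:R * (S0 r h)%:~R - 2 ^+ H,
      forall s : nat, (s + 2 <= N)%N ->
        T_orb (p ^ N) (p ^ s) r h (alpha R (p ^ N)) =
          (totient (p ^ (N - s)))%:R * (S0 r h)%:~R
    & T_sum (p ^ N) r h (alpha R (p ^ N)) =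
        (p ^ N)%:R * (S0 r h)%:~R - 2 ^+ H].
Proof.
move=> H B N1 pp Bp _; have p0 := prime_gt0 pp; have p1 := prime_gt1 pp.
pose g (x : R) := \prod_(j < t) (2 * cos ((tnth r j)%:~R * x)) ^+ tnth h j.
pose P m := \sum_(0 <= k < m) g (node R m k).
have PE m : (B < m)%N -> P m = m%:R * (S0 r h)%:~R.
  move=> Bm; rewrite /S0 /constant_coef.
  (* Frequency 0 picks out the constant coefficient. *)
  rewrite -(@quadrature_prod R m 'I_t _ (tnth r) (tnth h) 0) //.
  by apply: eq_bigr => k _; rewrite mul0r cos0 mul1r.
have g0 : g 0 = 2 ^+ H.
  by rewrite /g /H -prodrXr; apply: eq_bigr => j _; rewrite mulr0 cos0 mulr1.
have node0 m : node R m 0 = 0 by rewrite /node mulr0 mul0r.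
have P1 : P 1%N = 2 ^+ H by rewrite /P big_nat1 node0 g0.
have Bpe e : (0 < e)%N -> (B < p ^ e)%N.
  by move=> e0; apply: (leq_trans Bp); rewrite -{1}[p]expn1 leq_exp2l.
have pN0 : (0 < p ^ N)%N by rewrite expn_gt0 p0.
have gE k : \prod_(j < t) (2 * alpha R (p ^ N) (sigma (p ^ N) (tnth r j) k)) ^+ tnth h j
    = g (node R (p ^ N) k).
  by apply: eq_bigr => j _; rewrite alpha_sigma.
(* Multiples of [p ^ e] on the fine grid are exactly the nodes of the coarser grid. *)
have nodeM e j : (e <= N)%N ->
    node R (p ^ N) (j * p ^ e)%N = node R (p ^ (N - e)) j.
  move=> eN; rewrite /node -{1}(subnK eN) expnD !natrM.
  by field; rewrite !pnatr_eq0 !expn_eq0 !negb_and -!lt0n p0.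
have orbE s : (s < N)%N ->
    T_orb (p ^ N) (p ^ s) r h (alpha R (p ^ N)) =
    P (p ^ (N - s))%N - P (p ^ (N - s.+1))%N.
  move=> sN; rewrite /T_orb; under eq_bigr do rewrite gE.
  rewrite (sum_gcd_pfactor (fun k => g (node R (p ^ N) k))) //.
  by congr (_ - _); apply: eq_bigr => j _; rewrite nodeM // ltnW.
split.
- rewrite orbE; last by lia.
  (* The subtracted sum is [P 1], evaluated directly because [PE] would require [B < 1]. *)
  by rewrite subKn // subnS subKn // expn0 expn1 P1 PE.
- move=> s sN; rewrite orbE; last by lia.
  (* Since [s + 2 <= N], both exponents are positive and both sums are exact. *)
  rewrite !PE; try by apply: Bpe; lia.
  rewrite -mulrBl totient_pfactor //; last by lia.
  rewrite subnS -natrB; last by rewrite leq_exp2l // leq_pred.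
  congr (_%:R * _); have -> : (N - s = (N - s).-1.+1)%N by lia.
  by rewrite /= expnS; nia.
- rewrite /T_sum; under eq_bigr do rewrite gE.
  (* [T_sum] differs from [P (p ^ N)] only by the term at [k = 0], which is [g 0]. *)
  rewrite -(PE (p ^ N)%N) ?Bpe // /P [in RHS]big_ltn // node0 g0.
  by rewrite addrC addKr.
Qed.
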